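(* Let $\mathbb{K}$ be a field and let $\mathcal{C}$ be an $[n,3,d]$-linear code over $\mathbb{K}$ such that the linear forms of $\Sigma_{\mathcal{C}}=(\ell_1,\ldots,\ell_n)$ are pairwise nonproportional. Assume that the Orlik-Terao ideal $\mathrm{IOT}(\mathcal{C})$ is not the zero ideal, and let $\delta$ denote the length of the linear strand of $\mathrm{IOT}(\mathcal{C})$. Then: (1) If $\alpha(\mathrm{IOT}(\mathcal{C}))=3$, then $\mathcal{C}$ is an MDS code. (2) If $\alpha(\mathrm{IOT}(\mathcal{C}))=2$, then $d\ge n-\delta-3$.
   Context: An $[n,k,d]$-linear code $\mathcal{C}$ over a field $\mathbb{K}$ is the image of an injective linear map $\mathbb{K}^k\to\mathbb{K}^n$, $\mathbf{x}\mapsto \mathbf{x}G$, where $G=(a_{ij})$ is a $k\times n$ matrix of rank $k$; $d$ is the smallest number of nonzero entries in a nonzero element of $\mathcal{C}$. The code is MDS if $d=n-k+1$. $\Sigma_{\mathcal{C}}=(\ell_1,\ldots,\ell_n)$ with $\ell_j=\sum_{i=1}^k a_{ij}x_i\in\mathbb{K}[x_1,\ldots,x_k]$; pairwise nonproportional means $\gcd(\ell_i,\ell_j)=1$ for $i\ne j$, with all $\ell_i\neq 0$. Orlik-Terao ideal: let $S=\mathbb{K}[y_1,\ldots,y_n]$ (standard grading) and let $\phi:S\to\mathbb{K}[1/\ell_1,\ldots,1/\ell_n]$ be the ring epimorphism $\phi(y_i)=1/\ell_i$. Then $\mathrm{IOT}(\mathcal{C})=\ker(\phi)$, a homogeneous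 ideal of $S$. For a nonzero finitely generated graded $S$-module $M=\bigoplus_{i\ge 0}M_i$, $\alpha(M)$ is the smallest $i$ with $M_i\ne0$. Length of the linear strand: put $\alpha=\alpha(M)$ and write the minimal graded free resolution of $M$ as $$\cdots\to \mathbf{F}_{\delta+1}\to S^{n_\delta}(-(\alpha+\delta))\oplus\mathbf{F}_\delta\to\cdots\to S^{n_0}(-\alpha)\oplus\mathbf{F}_0\to M\to0,$$ where each $\mathbf{F}_j$ is zero or satisfies $\alpha(\mathbf{F}_j)\ge\alpha+j+1$ and $n_\delta\ne0$. Then $\delta$ is the length of the linear strand of $M$; that is, $\delta$ is the largest $i$ such that $S(-(\alpha+i))$ is a summand of the $i$-th module in the minimal graded free resolution of $M$. *)

(* Defs.v *)
From HB Require Import structures.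
From mathcomp Require Import all_boot all_order all_algebra.
From mathcomp Require Import fraction.
From mathcomp.multinomials Require Export mpoly.
Set Implicit Arguments.
Unset Strict Implicit.
Unset Printing Implicit Defensive.
Import GRing.Theory.
Local Open Scope ring_scope.

Section Codes.
Variables (K : fieldType) (k n : nat).
Implicit Types (G : 'M[K]_(k, n)) (c : 'rV[K]_n) (d : nat).

Definition code G c : Prop := exists x : 'rV[K]_k, c = x *m G.

Definition weight c : nat := #|[set j | c 0 j != 0]|.

Definition is_min_distance G d : Prop :=
  (exists c, [/\ code G c, c <> 0 & weight c = d]) /\
  (forall c, code G c -> c <> 0 -> (d <= weight c)%N).

Definition is_linear_code G d : Prop := \rank G = k /\ is_min_distance G d.

(* [k <= n] whenever [G] has rank [k], so the subtraction is not truncated. *)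
Definition is_MDS G : Prop := is_linear_code G (n - k + 1)%N.

Definition code_form G (j : 'I_n) : {mpoly K[k]} := \sum_(i < k) G i j *: 'X_i.

(* gcd(p, q) = 1: every common divisor is a unit. *)
Definition gcd_one (p q : {mpoly K[k]}) : Prop :=
  forall g a b : {mpoly K[k]}, p = g * a -> q = g * b -> g \is a GRing.unit.

Definition pairwise_nonproportional G : Prop :=
  (forall j, code_form G j <> 0) /\
  (forall i j, i <> j -> gcd_one (code_form G i) (code_form G j)).

(* The K-algebra map y_j |-> 1 / l_j.  Its target K[1/l_1, ..., 1/l_n] is a
   subring of the field of fractions, so the kernel may be computed there. *)
Definition orlik_terao_map G : {mpoly K[n]} -> {fraction {mpoly K[k]}} :=
  mmap (fun a : K => FracField.tofrac (a%:MP : {mpoly K[k]}))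
       (fun j => (FracField.tofrac (code_form G j))^-1).

Definition IOT G (f : {mpoly K[n]}) : Prop := orlik_terao_map G f = 0.

End Codes.

Section LinearStrand.
Variables (K : fieldType) (n : nat).
Local Notation S := {mpoly K[n]}.
Implicit Types (I : S -> Prop) (s delta : nat).

(* alpha(I) = s for a homogeneous ideal I *)
Definition is_alpha I s : Prop :=
  (exists f, [/\ I f, f <> 0 & f \is s.-homog]) /\
  (forall b f, I f -> f <> 0 -> f \is b.-homog -> (s <= b)%N).

(* The free modules are F_i = \bigoplus_(j < res_rank i) S(- res_shift i j),
   with elements written as row vectors, so that the j-th basis vector of F_i
   has degree [res_shift i j].  The maps
     ... -> F_2 -> F_1 -> F_0 -> I -> 0
   are right multiplications by the [res_diff i] and by the column [res_aug]
   of generators.  Vanishing ranks are allowed, so that finite resolutions are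
   covered. *)
Record min_graded_resolution I := MinGradedResolution {
  res_rank : nat -> nat;
  res_shift : forall i, 'I_(res_rank i) -> nat;
  res_aug : 'cV[S]_(res_rank 0);
  res_diff : forall i, 'M[S]_(res_rank i.+1, res_rank i);
  res_aug_homog : forall j, res_aug j 0 \is (res_shift j).-homog;
  (* The map has degree 0: each entry is zero or homogeneous, of degree the
     difference of the two shifts. *)
  res_diff_homog : forall i j l m, m \in msupp (res_diff i j l) ->
    (mdeg m + res_shift l = res_shift j)%N;
  (* Minimality: the image of F_(i+1) lies in (y_1, ..., y_n) F_i. *)
  res_minimal : forall i j l, (res_diff i j l)@_0%MM = 0;
  res_onto : forall f, I f <-> exists u : 'rV_(res_rank 0), u *m res_aug = f%:M;
  res_exact0 : forall u : 'rV_(res_rank 0),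
    u *m res_aug = 0 <-> exists v, u = v *m res_diff 0;
  res_exactS : forall i (u : 'rV_(res_rank i.+1)),
    u *m res_diff i = 0 <-> exists v, u = v *m res_diff i.+1
}.

(* delta is the largest i such that S(-(alpha(I) + i)) is a summand of F_i.
   Minimal graded free resolutions are unique up to isomorphism, so the choice
   of [F] is immaterial. *)
Definition is_linear_strand_length I delta : Prop :=
  exists s (F : min_graded_resolution I),
    [/\ is_alpha I s,
        exists j : 'I_(res_rank F delta), res_shift j = (s + delta)%N
      & forall i (j : 'I_(res_rank F i)),
          res_shift j = (s + i)%N -> (i <= delta)%N].

End LinearStrand.

(* Main.v *)
Require Import Defs.
From mathcomp Require Import all_boot all_order all_algebra.
From mathcomp Require Import fraction perm.
Set Implicit Arguments.
Unset Strict Implicit.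
Unset Printing Implicit Defensive.
Import GRing.Theory.
Local Open Scope ring_scope.

(** A codeword of minimal weight d vanishes at m = n - d positions, and the
    linear forms at these positions lie in a common plane of the space of
    linear forms. Both claims come from the quadrics that such a coplanar
    family forces into the Orlik-Terao ideal.

    Fix two forms l_o, l_p of the family. Each other member l_a satisfies l_p
    = al_a l_o + be_a l_a with be_a <> 0; dividing by l_o l_a shows that w_a =
    al_a y_a + be_a y_o is sent to (l_p / l_o) (1 / l_a). Hence the rows (y_a)
    and (w_a), with a running over the m - 1 positions other than o, become
    proportional under y_j |-> 1 / l_j, and their 2 x 2 minors are quadrics of
    the ideal. If m >= 3 there is such a minor and it is nonzero, so alpha = 3
    forces m <= 2, which together with the Singleton bound is the MDS
    property.

    For the linear strand the minors are assembled into one Koszul cycle, as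
    in the last module of the Eagon-Northcott complex: a word s of m - 3
    letters is sent to the determinant whose rows are the unit vectors e_s
    followed by (y_a) and (w_a) ([curve_cycle]). It is alternating, it takes
    values in the quadrics of the ideal, it is nonzero, and its Koszul
    boundary vanishes because it is a determinant in which the row (y_a)
    occurs twice.

    A nonzero Koszul i-cycle with values in the lowest degree part of an ideal
    is a nonzero class of Tor_i of lowest degree, hence forces a generator of
    the linear strand in homological degree i ([linear_strand_koszul]). This
    is proved directly on a given minimal resolution: the cycle is lifted step
    by step to vectors of constants, minimality making every lift unique. With
    i = m - 3 this gives m - 3 <= delta when alpha = 2, which is the bound on
    d = n - m. *)

(** * Alternating cochains and the Koszul boundary *)

Section AlternatingCochains.
Variables (T : finType) (S : comNzRingType) (x : T -> S).

(** Elements of the tensor product of [V] with an exterior algebra are encoded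
    by their coefficients on all words in the alphabet [T]. The second clause
    is needed in characteristic 2. *)
Definition alternating (V : zmodType) (u : seq T -> V) : Prop :=
  (forall s1 a b s2, u (s1 ++ a :: b :: s2) = - u (s1 ++ b :: a :: s2)) /\
  (forall s1 a s2, u (s1 ++ a :: a :: s2) = 0).

Definition koszul (V : lmodType S) (u : seq T -> V) (s : seq T) : V :=
  \sum_a x a *: u (a :: s).

Lemma sum_antisym_eq0 (V : zmodType) (g : T -> T -> V) :
  (forall a b, g a b = - g b a) -> (forall a, g a a = 0) ->
  \sum_a \sum_b g a b = 0.
Proof.
move=> gN g0; pose lt (a b : T) := (enum_rank a < enum_rank b)%N.
have -> : \sum_a \sum_b g a b =
    \sum_a \sum_(b | lt a b) g a b + \sum_a \sum_(b | lt b a) g a b.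
  rewrite -big_split; apply: eq_bigr => a _ /=.
  rewrite (bigID (lt a)) /=; congr (_ + _).
  rewrite (bigID (fun b => b == a)) /= big1 ?add0r; last first.
    by move=> b /andP[_ /eqP->].
  apply: eq_bigl => b; rewrite /lt -leqNgt leq_eqVlt.
  rewrite (inj_eq val_inj) (inj_eq enum_rank_inj).
  by case: eqVneq => [->|] /=; rewrite ?ltnn ?andbT ?andbF.
rewrite [X in _ + X](exchange_big_dep xpredT) //= -big_split big1 // => a _ /=.
by rewrite -big_split big1 // => b _ /=; rewrite gN addNr.
Qed.

(** The coefficients [x a * x b] are symmetric in [a] and [b], whereas [u] is
    alternating in its two leading letters. *)
Lemma koszul_koszul (V : lmodType S) (u : seq T -> V) s :
  alternating u -> koszul (koszul u) s = 0.
Proof.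
case=> uN u0; rewrite /koszul.
under eq_bigr do rewrite scaler_sumr.
apply: sum_antisym_eq0 => [a b|a]; rewrite !scalerA; last first.
  by rewrite (u0 [::]) scaler0.
by rewrite (uN [::]) scalerN mulrC.
Qed.

Lemma alternating_koszul (V : lmodType S) (u : seq T -> V) :
  alternating u -> alternating (koszul u).
Proof.
case=> uN u0; split=> [s1 a b s2|s1 a s2]; rewrite /koszul.
  by rewrite -sumrN; apply: eq_bigr => c _; rewrite -!cat_cons uN scalerN.
by apply: big1 => c _; rewrite -!cat_cons u0 scaler0.
Qed.

Lemma eq_koszul (V : lmodType S) (u u' : seq T -> V) s :
  u =1 u' -> koszul u s = koszul u' s.
Proof. by move=> uu'; apply: eq_bigr => a _; rewrite uu'. Qed.

Lemma koszul_mulmx a b c (u : seq T -> 'M[S]_(a, b)) (D : 'M[S]_(b, c)) s :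
  koszul (fun r => u r *m D) s = koszul u s *m D.
Proof. by rewrite mulmx_suml; apply: eq_bigr => t _; rewrite scalemxAl. Qed.

End AlternatingCochains.

(** * Koszul cycles and the linear strand of a minimal resolution *)

Section LinearStrandLift.
Variables (K : fieldType) (n : nat).
Local Notation S := {mpoly K[n]}.
Local Notation cst := (map_mx (@mpolyC n K)).

(** [D] has degree 0 as a map between the free modules with shifts [sa] and
    [sb]; a single row with shift [t] is then a homogeneous element of degree
    [t]. *)
Definition graded_mx a b (sa : 'I_a -> nat) (sb : 'I_b -> nat)
    (D : 'M[S]_(a, b)) : Prop :=
  forall j l m, m \in msupp (D j l) -> (mdeg m + sb l = sa j)%N.

Lemma cst_mulmxE a b (c : 'rV[K]_a) (D : 'M[S]_(a, b)) l m :
  ((cst c *m D) 0 l)@_m = \sum_j c 0 j * (D j l)@_m.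
Proof.
rewrite mxE raddf_sum; apply: eq_bigr => j _ /=.
by rewrite mxE mcoeffCM.
Qed.

(** When no term of [q] has degree below that of [m], only the constant term of
    [p] can contribute to [m] in [p * q]. *)
Lemma mcoeffM_low (p q : S) m :
  (forall m', m' \in msupp q -> (mdeg m <= mdeg m')%N) ->
  (p * q)@_m = p@_0%MM * q@_m.
Proof.
move=> q_high; pose p' := p - (p@_0%MM)%:MP.
have {1}-> : p = (p@_0%MM)%:MP + p' by rewrite addrC subrK.
rewrite mulrDl mcoeffD mcoeffCM; suff -> : (p' * q)@_m = 0 by rewrite addr0.
apply: memN_msupp_eq0; apply/negP => /msuppM_le/allpairsP[[m1 m2] /= [h1 h2 em]].
have := q_high _ h2; rewrite em mdegD -{2}[mdeg m2]add0n leq_add2r leqn0.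
rewrite mdeg_eq0 => /eqP m10; move: h1; rewrite mcoeff_msupp m10.
by rewrite mcoeffB mcoeffC eqxx mulr1 subrr eqxx.
Qed.

(** In the lowest degree [t] of the source, a homogeneous element of the image
    comes from constants: replace each coefficient by its constant term. *)
Lemma graded_lift a b (sa : 'I_a -> nat) (sb : 'I_b -> nat)
    (D : 'M[S]_(a, b)) t (v : 'rV[S]_a) :
  graded_mx sa sb D -> (forall j, t <= sa j)%N ->
  graded_mx (fun _ : 'I_1 => t) sb (v *m D) ->
  exists c : 'rV[K]_a,
    v *m D = cst c *m D /\ forall j, c 0 j != 0 -> sa j = t.
Proof.
move=> gD sa_ge gw.
pose c : 'rV[K]_a := \row_j (if sa j == t then (v 0 j)@_0%MM else 0).
exists c; split=> [|j]; last first.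
  by rewrite mxE; case: (eqVneq (sa j) t); rewrite ?eqxx.
apply/rowP => l; apply/mpolyP => m; rewrite cst_mulmxE.
have [em|nem] := eqVneq (mdeg m + sb l)%N t.
  rewrite mxE raddf_sum; apply: eq_bigr => j _ /=.
  rewrite mcoeffM_low => [|m' /gD em']; last first.
    by rewrite -(leq_add2r (sb l)) em em' sa_ge.
  rewrite mxE; case: (eqVneq (sa j) t) => // ne.
  rewrite mul0r [(D j l)@_m]memN_msupp_eq0 ?mulr0 //; apply: contra ne => /gD <-.
  by rewrite em.
rewrite memN_msupp_eq0; last by apply: contra nem => /gw ->.
rewrite big1 // => j _; rewrite mxE; case: eqP => [ej|]; last by rewrite mul0r.
rewrite [(D j l)@_m]memN_msupp_eq0 ?mulr0 //; apply: contra nem => /gD ->.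
by rewrite ej.
Qed.

Section Cochains.
Variables (N : nat) (f : 'I_N -> 'I_n).
Hypothesis f_inj : injective f.
Local Notation x := (fun a => 'X_(f a) : S).

(** The variables of distinct letters are linearly independent over [K]. *)
Lemma koszul_cst_eq0 a (u : seq 'I_N -> 'rV[K]_a) s :
  koszul x (cst \o u) s = 0 -> forall i, u (i :: s) = 0.
Proof.
move=> /rowP us0 i; apply/rowP => l; have := us0 l.
rewrite !mxE summxE => /(congr1 (mcoeff U_(f i))).
rewrite mcoeff0 raddf_sum (bigD1 i) //= big1 ?addr0 => [|i' ne].
  by rewrite !mxE mulrC mcoeffCM mcoeffXU eqxx mulr1.
by rewrite !mxE mulrC mcoeffCM mcoeffXU (inj_eq f_inj) (negPf ne) mulr0.
Qed.

Lemma graded_koszul_cst a (sa : 'I_a -> nat) t (u : seq 'I_N -> 'rV[K]_a) s :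
  (forall s j, u s 0 j != 0 -> sa j = t) ->
  graded_mx (fun _ : 'I_1 => t.+1) sa (koszul x (cst \o u) s).
Proof.
move=> ut j l m; rewrite ord1 summxE => ml.
have [i /andP[ui mi]] : exists i, (u (i :: s) 0 l != 0) && (m == U_(f i)%MM).
  apply/existsP; apply: contraLR ml; rewrite negb_exists => /forallP h.
  rewrite -mcoeff_eq0 raddf_sum big1 // => i _ /=.
  rewrite !mxE mulrC mcoeffCM mcoeffX; have := h i; rewrite negb_and negbK.
  case/orP => [/eqP->|]; first by rewrite mul0r.
  by rewrite eq_sym => /negPf->; rewrite mulr0.
by rewrite (ut _ _ ui) (eqP mi) mdeg1.
Qed.

(** Lifts of lowest degree are constants and hence unique when [D] is injective
    on constants.  Uniqueness is what makes the lift of an alternating cochain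
    alternating. *)
Lemma graded_lift_cochain a b (sa : 'I_a -> nat) (sb : 'I_b -> nat)
    (D : 'M[S]_(a, b)) t (Z : seq 'I_N -> 'rV[S]_b) :
  graded_mx sa sb D -> (forall j, t <= sa j)%N ->
  (forall c : 'rV[K]_a, cst c *m D = 0 -> c = 0) ->
  alternating Z ->
  (forall s, graded_mx (fun _ : 'I_1 => t) sb (Z s)) ->
  (forall s, exists v, Z s = v *m D) ->
  exists u : seq 'I_N -> 'rV[K]_a,
    [/\ forall s, Z s = cst (u s) *m D, alternating u
      & forall s j, u s 0 j != 0 -> sa j = t].
Proof.
move=> gD sa_ge D_inj [ZN Z0] gZ ZD.
pose P s (c : 'rV[K]_a) :=
  (Z s == cst c *m D) && [forall j, (c 0 j != 0) ==> (sa j == t)].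
have exP s : exists c, P s c.
  have [v ev] := ZD s; have gv := gZ s; rewrite ev in gv.
  have [c [ec cs]] := graded_lift gD sa_ge gv.
  exists c; rewrite /P ev ec eqxx /=; apply/forallP => j; apply/implyP => cj.
  by apply/eqP/cs.
pose u s := xchoose (exP s).
have uP s : Z s = cst (u s) *m D by have /andP[/eqP] := xchooseP (exP s).
exists u; split=> // [|s j cj]; last first.
  by have /andP[_ /forallP/(_ j)/implyP/(_ cj)/eqP] := xchooseP (exP s).
split=> [s1 i j s2|s1 i s2].
  apply/eqP; rewrite -addr_eq0; apply/eqP/D_inj.
  by rewrite map_mxD mulmxDl -!uP ZN addNr.
by apply: D_inj; rewrite -uP.
Qed.

End Cochains.

Section Resolution.
Variables (I : S -> Prop) (s0 : nat) (F : min_graded_resolution I).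
Hypothesis I_low : forall b f, I f -> f <> 0 -> f \is b.-homog -> (s0 <= b)%N.

Lemma res_image_const0 i (v : 'rV[S]_(res_rank F i.+1)) j :
  ((v *m res_diff F i) 0 j)@_0%MM = 0.
Proof.
rewrite mxE raddf_sum big1 // => l _ /=.
by rewrite mcoeffM_low ?mdeg0 // res_minimal mulr0.
Qed.

(** By minimality the image of a differential has no constant terms, so no
    basis vector is a boundary. *)
Lemma delta_not_image i j (v : 'rV[S]_(res_rank F i.+1)) :
  delta_mx 0 j <> v *m res_diff F i.
Proof.
move=> /(congr1 (fun w : 'rV_ _ => (w 0 j)@_0%MM)); rewrite res_image_const0.
by rewrite mxE !eqxx mcoeff1 eqxx => /eqP; rewrite oner_eq0.
Qed.

(** The degrees of the generators grow by at least 1 at each step: a basis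
    vector is not mapped to 0, for it would be a boundary, and its image has
    nonconstant entries. *)
Lemma res_shift_ge i (j : 'I_(res_rank F i)) : (s0 + i <= res_shift j)%N.
Proof.
elim: i j => [|i IHi] j.
  rewrite addn0; apply: (I_low _ _ (res_aug_homog j)).
    apply/(res_onto F); exists (delta_mx 0 j).
    by rewrite -rowE; apply/rowP => l; rewrite !mxE !ord1 eqxx mulr1n.
  move=> a0; have /res_exact0[v] : (delta_mx 0 j : 'rV_ _) *m res_aug F = 0.
    by rewrite -rowE; apply/rowP => l; rewrite !mxE !ord1.
  exact: delta_not_image.
have [D0|] := eqVneq (row j (res_diff F i)) 0.
  have /res_exactS[v] : (delta_mx 0 j : 'rV_ _) *m res_diff F i = 0.
    by rewrite -rowE.
  by move/delta_not_image.
case/rV0Pn => l; rewrite mxE => Dn0; have m_in := mlead_supp Dn0.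
rewrite -(res_diff_homog m_in) addnS.
apply: (leq_ltn_trans (IHi l)); rewrite -[X in (X < _)%N]add0n ltn_add2r.
rewrite lt0n mdeg_eq0; apply: contraL m_in => /eqP->.
by rewrite -mcoeff_eq0 res_minimal.
Qed.

Lemma res_diff_cst_inj i (c : 'rV[K]_(res_rank F i.+1)) :
  cst c *m res_diff F i = 0 -> c = 0.
Proof.
case/res_exactS => v ec; apply/rowP => j.
by have := res_image_const0 v j; rewrite -ec !mxE mcoeffC eqxx mulr1.
Qed.

Lemma res_aug_cst_inj (c : 'rV[K]_(res_rank F 0)) :
  cst c *m res_aug F = 0 -> c = 0.
Proof.
case/res_exact0 => v ec; apply/rowP => j.
by have := res_image_const0 v j; rewrite -ec !mxE mcoeffC eqxx mulr1.
Qed.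

(** A nonzero Koszul [i]-cycle with values in the lowest degree part of [I] is
    a nonzero class of Tor_i(I, K) in degree [s0 + i]. It is carried through
    the resolution as in the comparison of the two ways to compute Tor: given
    an alternating cochain [u] of constants in the [k]-th module, its Koszul
    boundary is killed by the differential, so it lifts to constants in the
    next module. Each lift lives on words with one letter less, and it is
    nonzero since a nonzero cochain of constants on nonempty words has a
    nonzero boundary; after [i] steps a nonzero vector of constants of degree
    [s0 + i] remains. *)
Lemma linear_strand_koszul N (f : 'I_N -> 'I_n) (i : nat) (z : seq 'I_N -> S) :
  injective f ->
  alternating z ->
  (forall s, I (z s)) ->
  (forall s, z s \is s0.-homog) ->
  (forall s, size s != i -> z s = 0) ->
  (forall s, \sum_a 'X_(f a) * z (a :: s) = 0) ->
  (exists s, z s != 0) ->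
  exists j : 'I_(res_rank F i), res_shift j = (s0 + i)%N.
Proof.
move=> f_inj [zN z0] zI zh z_supp dz [s1 zs1].
pose x a : S := 'X_(f a).
have strand k : (k <= i)%N -> exists u : seq 'I_N -> 'rV[K]_(res_rank F k),
   [/\ alternating u, forall s j, u s 0 j != 0 -> res_shift j = (s0 + k)%N,
       forall s, (size s + k)%N != i -> u s = 0,
       forall s, exists v, koszul x (cst \o u) s = v *m res_diff F k
     & exists s, u s != 0].
  elim: k => [_|k IHk lt_ki].
    have [||||||u [uE u_alt u_sh]] := @graded_lift_cochain N _ _
        (@res_shift _ _ _ F 0) (fun=> 0%N) (res_aug F) s0 (fun s => (z s)%:M).
    - by move=> j l m; rewrite addn0 ord1; apply/dhomogP/res_aug_homog.
    - by move=> j; rewrite -[s0]addn0; apply: res_shift_ge.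
    - exact: res_aug_cst_inj.
    - by split=> [s a b s'|s a s']; rewrite ?z0 ?raddf0 // zN raddfN.
    - move=> s j l m; rewrite !ord1 mxE eqxx mulr1n addn0; exact/dhomogP.
    - by move=> s; have /(res_onto F)[v ev] := zI s; exists v.
    exists u; split=> //.
    - by move=> s j /u_sh->; rewrite addn0.
    - move=> s; rewrite addn0 => /z_supp zs0; apply: res_aug_cst_inj.
      by rewrite -uE zs0 raddf0.
    - move=> s; apply/res_exact0; rewrite -koszul_mulmx.
      under eq_koszul do rewrite /= -uE.
      rewrite /koszul -[RHS](raddf0 (@scalar_mx S 1)) -(dz s) raddf_sum.
      by apply: eq_bigr => a _; rewrite scale_scalar_mx.
    - exists s1; apply: contra zs1 => /eqP us0; have := uE s1.
      rewrite us0 map_mx0 mul0mx => /rowP/(_ 0); rewrite !mxE eqxx mulr1n.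
      by move/eqP.
  have [u [u_alt u_sh u_supp uD [s us]]] := IHk (ltnW lt_ki).
  have cu_alt : alternating (cst \o u).
    case: u_alt => uN u0; split=> [r1 a b r2|r1 a r2] /=; last by rewrite u0 raddf0.
    by rewrite uN raddfN.
  have [||||||u' [uE u'_alt u'_sh]] := @graded_lift_cochain N _ _
      (@res_shift _ _ _ F k.+1) (@res_shift _ _ _ F k) (res_diff F k)
      (s0 + k).+1 (koszul x (cst \o u)).
  - exact: res_diff_homog.
  - by move=> j; rewrite -addnS; apply: res_shift_ge.
  - exact: res_diff_cst_inj.
  - exact: alternating_koszul.
  - by move=> r; apply: graded_koszul_cst.
  - exact: uD.
  exists u'; split=> //.
  - by move=> r j /u'_sh->; rewrite addnS.
  - move=> r sz_r; apply: res_diff_cst_inj; rewrite -uE.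
    by apply: big1 => a _; rewrite /= u_supp ?map_mx0 ?scaler0 //= addSnnS.
  - move=> r; apply/res_exactS; rewrite -koszul_mulmx.
    under eq_koszul do rewrite /= -uE.
    exact: koszul_koszul.
    (* Only words of length i - k > 0 count, so the witness has a head letter. *)
  - case: s us => [|a s] us.
      by rewrite u_supp ?eqxx // add0n neq_ltn lt_ki in us.
    exists s; apply: contra us => /eqP us0; apply/eqP.
    apply: (koszul_cst_eq0 f_inj); rewrite -/x.
    by have := uE s; rewrite us0 map_mx0 mul0mx.
have [u [_ u_sh _ _ [s us]]] := strand i (leqnn i).
have [j uj] : exists j, u s 0 j != 0 by apply/rV0Pn.
by exists j; apply: u_sh uj.
Qed.
End Resolution.
End LinearStrandLift.

(** * Determinants of lists of rows *)

Section DeterminantOfRows.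
Variables (R : comNzRingType) (N : nat).
Implicit Types (r : seq 'rV[R]_N) (v w : 'rV[R]_N).

Definition rows_mx r : 'M[R]_N := \matrix_(i < N) r`_i.

Lemma det_rows_repeat r i j :
  (i < j < N)%N -> r`_i = r`_j -> \det (rows_mx r) = 0.
Proof.
case/andP=> ij jN rij.
apply: (@determinant_alternate _ _ _ (Ordinal (ltn_trans ij jN)) (Ordinal jN)).
  by rewrite -val_eqE /= neq_ltn ij.
by move=> c; rewrite !mxE /= rij.
Qed.

Lemma det_rows_swap r1 v w r2 : ((size r1).+1 < N)%N ->
  \det (rows_mx (r1 ++ v :: w :: r2)) = - \det (rows_mx (r1 ++ w :: v :: r2)).
Proof.
move=> lt1N; pose i := Ordinal (ltnW lt1N); pose j := Ordinal lt1N.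
have -> : rows_mx (r1 ++ v :: w :: r2) =
    xrow i j (rows_mx (r1 ++ w :: v :: r2)).
  apply/row_matrixP => c; rewrite rowK; apply/rowP => l; rewrite !mxE.
  congr ((_ : 'rV_N) 0 l); rewrite !nth_cat /=.
  case: tpermP => [->|->|/eqP ci /eqP cj].
  - by rewrite /= ltnn subnn ltnNge leqnSn subSnn.
  - by rewrite /= ltnn subnn ltnNge leqnSn subSnn.
  - case: ltnP => // le1c.
    move: ci cj; rewrite -!val_eqE /= => /negPf ci /negPf cj.
    have: (val c - size r1 != 0)%N.
      by rewrite subn_eq0 -ltnNge ltn_neqAle eq_sym ci le1c.
    case e: (val c - size r1)%N => [|[|k]] //= _.
    by move: cj; rewrite -(subnK le1c) e add1n eqxx.
rewrite xrowE det_mulmx /tperm_mx det_perm odd_tperm -val_eqE /=.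
by rewrite neq_ltn ltnSn /= expr1 mulN1r.
Qed.

(** The Laplace expansion along the head row, whose cofactors do not see that
    row. *)
Lemma det_rows_head v r : (0 < N)%N ->
  \det (rows_mx (v :: r)) = \sum_a v 0 a * \det (rows_mx (delta_mx 0 a :: r)).
Proof.
move=> N0; pose i := Ordinal N0.
have cofE u a : cofactor (rows_mx (u :: r)) i a = cofactor (rows_mx (v :: r)) i a.
  congr (_ * \det _); apply/matrixP => b c; rewrite !mxE.
  by congr ((_ : 'rV_N) 0 _); rewrite /= /bump /=.
rewrite (expand_det_row _ i); apply: eq_bigr => a _; rewrite !mxE /=; congr (_ * _).
rewrite (expand_det_row _ i) (bigD1 a) //= big1 ?addr0 => [|b ne].
  by rewrite !mxE !eqxx mul1r cofE.
by rewrite !mxE /= (negPf ne) mul0r.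
Qed.

End DeterminantOfRows.

Lemma det_mx2 (R : comNzRingType) (A : 'M[R]_2) :
  \det A = A 0 0 * A 1 1 - A 0 1 * A 1 0.
Proof.
rewrite (expand_det_row _ 0) !big_ord_recl big_ord0 addr0 /cofactor !det_mx11.
rewrite !mxE /= expr0 expr1 mul1r mulN1r mulrN.
by congr (A _ _ * A _ _ - A _ _ * A _ _); apply/val_inj.
Qed.

(** * A Koszul cycle of quadrics on a rational normal curve *)

Section RationalNormalCurveCycle.
Variables (K : fieldType) (k n N : nat) (G : 'M[K]_(k, n)).
Variables (f : 'I_(N + 2) -> 'I_n) (o p : 'I_n) (al be : 'I_(N + 2) -> K).
Hypothesis f_inj : injective f.
Hypothesis f_neq_o : forall a, f a != o.
Hypothesis be_neq0 : forall a, be a != 0.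
Hypothesis forms_neq0 : forall j, code_form G j != 0.
Hypothesis form_rel : forall a,
  code_form G p = al a *: code_form G o + be a *: code_form G (f a).
Local Notation S := {mpoly K[n]}.

Let y : 'rV[S]_(N + 2) := \row_a 'X_(f a).
Let w : 'rV[S]_(N + 2) := \row_a (al a *: 'X_(f a) + be a *: 'X_o).

(** Modulo the Orlik-Terao ideal, [w] is the multiple of [y] by l_p / l_o, so
    the 2 x 2 minors of the matrix with rows [y] and [w] are quadrics of that
    ideal; they cut out a rational normal curve. Stacking the unit vectors of
    distinct letters on [y] and [w] selects one such minor up to sign, and
    makes the result alternating in these letters. This is an element of the
    last syzygy module in the Eagon-Northcott resolution, written as a Koszul
    cycle. *)
Definition curve_cycle (s : seq 'I_(N + 2)) : S :=
  if size s == N then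
    \det (rows_mx ([seq delta_mx 0 a | a <- s] ++ [:: y; w]))
  else 0.

Lemma alternating_curve_cycle : alternating curve_cycle.
Proof.
have lt_rows c d e : (c + d = e)%N -> (c.+1 < e + 2)%N.
  by move=> <-; rewrite addn2 !ltnS leq_addr.
split=> [s1 a b s2|s1 a s2]; rewrite /curve_cycle !size_cat /=.
  case: eqP => [eN|_]; last by rewrite oppr0.
  rewrite !map_cat /= -!catA /= det_rows_swap // size_map.
  exact: lt_rows eN.
case: eqP => // eN; rewrite map_cat /= -catA /=.
apply: (det_rows_repeat (i := size s1) (j := (size s1).+1)).
  by rewrite ltnSn; apply: lt_rows eN.
by rewrite !nth_cat size_map ltnn subnn ltnNge leqnSn subSnn.
Qed.

(** Summing against the variables replaces the head row of the determinant by
    [y], which already is one of its rows. *)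
Lemma koszul_curve_cycle s : \sum_a 'X_(f a) * curve_cycle (a :: s) = 0.
Proof.
rewrite /curve_cycle /=; case: eqP => [eN|_]; last first.
  by rewrite big1 // => a _; rewrite mulr0.
pose r := [seq delta_mx 0 a | a <- s] ++ [:: y; w].
have N2_gt0 : (0 < N + 2)%N by rewrite addn2.
transitivity (\sum_a y 0 a * \det (rows_mx (delta_mx 0 a :: r))).
  by apply: eq_bigr => a _; rewrite mxE.
rewrite -det_rows_head //.
apply: (det_rows_repeat (i := 0%N) (j := (size s).+1)) => /=.
  by rewrite eN addn2 ltnS leqnSn.
by rewrite /r nth_cat size_map ltnn subnn.
Qed.

(** In the Leibniz formula each product has one factor from [y], one from [w]
    and constants from the other rows. *)
Lemma curve_cycle_homog s : curve_cycle s \is 2.-homog.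
Proof.
rewrite /curve_cycle; case: eqP => [eN|_]; last exact: dhomog0.
rewrite /(\det _); apply: rpred_sum => g _; rewrite mulr_sign.
suff prod2 :
    (\prod_i rows_mx ([seq delta_mx 0 a | a <- s] ++ [:: y; w]) i (g i) : S)
      \is 2.-homog.
  by case: (odd_perm g); rewrite ?rpredN.
(* The factors from the unit rows, from y and from w, in this order. *)
rewrite big_split_ord /= !big_ord_recl big_ord0 mulr1.
apply: (dhomogM (d := 0) (e := 2)); last apply: (dhomogM (d := 1) (e := 1)).
- elim/big_ind: _ => [|q1 q2 h1 h2|i _]; first exact: dhomog1.
    by apply: (dhomogM (d := 0) (e := 0)).
  rewrite !mxE /= nth_cat size_map eN ltn_ord.
  have i_s : (i < size s)%N by rewrite eN.
  rewrite (nth_map (g (lshift 2 i))) // mxE.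
  by case: (_ && _); rewrite ?dhomog1 ?dhomog0.
- by rewrite !mxE /= nth_cat size_map eN addn0 ltnn subnn mxE dhomogX /= mdeg1.
- rewrite !mxE /= nth_cat size_map eN ltnNge leq_addr /= addKn /= mxE.
  by rewrite rpredD // rpredZ // dhomogX /= mdeg1.
Qed.

(** Over the fraction field the rows that come from [y] and [w] become
    proportional, with ratio l_p / l_o. *)
Lemma curve_cycle_IOT s : IOT G (curve_cycle s).
Proof.
pose h j := (FracField.tofrac (code_form G j))^-1.
pose phi : {rmorphism S -> {fraction {mpoly K[k]}}} :=
  mmap (@FracField.tofrac _ \o @mpolyC k K) h.
rewrite /IOT; change (phi (curve_cycle s) = 0).
rewrite /curve_cycle; case: eqP => [eN|_]; last by rewrite rmorph0.
rewrite -det_map_mx; apply/eqP/det0P.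
pose ell j := FracField.tofrac (code_form G j).
have ell0 j : ell j != 0 by rewrite tofrac_eq0.
have phiX j : phi 'X_j = (ell j)^-1 by rewrite /phi /= mmapX mmap1U.
have phiZ c q : phi (c *: q) = FracField.tofrac (c%:MP : {mpoly K[k]}) * phi q.
  by rewrite -mul_mpolyC rmorphM /= /phi /= mmapC.
have phiw a : phi (w 0 a) = ell p / ell o * phi (y 0 a).
  rewrite !mxE rmorphD /= !phiZ !phiX.
  have -> : ell p = FracField.tofrac ((al a)%:MP : {mpoly K[k]}) * ell o +
      FracField.tofrac ((be a)%:MP : {mpoly K[k]}) * ell (f a).
    by rewrite /ell (form_rel a) -!mul_mpolyC tofracD !tofracM.
  rewrite !mulrDl mulfK // -!mulrA; congr (_ + _ * _).
  by rewrite mulrCA mulfV // mulr1.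
pose i0 : 'I_(N + 2) := rshift N ord0; pose i1 : 'I_(N + 2) := rshift N ord_max.
exists (delta_mx 0 i1 - (ell p / ell o) *: delta_mx 0 i0).
  apply/eqP => /rowP/(_ i1)/eqP; rewrite !mxE !eqxx.
  by rewrite (inj_eq (@rshift_inj _ _)) mulr0 subr0 oner_eq0.
rewrite mulmxBl -scalemxAl -!rowE; apply/rowP => a; rewrite [in RHS]mxE.
have rowM i c :
    ([seq delta_mx 0 a | a <- s] ++ [:: y; w])`_(N + i) 0 c = [:: y; w]`_i 0 c.
  by rewrite nth_cat size_map eN ltnNge leq_addr addKn.
by rewrite !mxE !rowM //= phiw subrr.
Qed.

(** With all but the last two letters [a], [b] chosen, what remains is the minor
    y_a w_b - y_b w_a, in which the monomial y_a y_o has coefficient [be b]. *)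
Lemma curve_cycle_neq0 : exists s, curve_cycle s != 0.
Proof.
have [s [ss sE]] : exists s : seq 'I_(N + 2),
    size s = N /\ forall (i : 'I_N) a, nth a s i = lshift 2 i.
  exists [seq lshift 2 i | i <- enum 'I_N]; split=> [|i a].
    by rewrite size_map size_enum_ord.
  by rewrite (nth_map i) ?size_enum_ord // nth_ord_enum.
exists s; rewrite /curve_cycle ss eqxx.
set M := rows_mx _.
have rowM (i : 'I_2) j : M (rshift N i) j = [:: y; w]`_i 0 j.
  by rewrite mxE nth_cat size_map ss /= ltnNge leq_addr /= addKn.
have rowM0 (i : 'I_N) j : M (lshift 2 i) j = (lshift 2 i == j)%:R.
  by rewrite mxE nth_cat size_map ss /= ltn_ord (nth_map j) ?ss // sE mxE eqxx eq_sym.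
have -> : M = block_mx 1%:M 0 (dlsubmx M) (drsubmx M).
  rewrite -[LHS]submxK; congr block_mx; apply/matrixP => i j.
    by rewrite [LHS]mxE [LHS]mxE rowM0 mxE (inj_eq (@lshift_inj _ _)).
  by rewrite [LHS]mxE [LHS]mxE rowM0 mxE eq_lrshift.
have drM (i j : 'I_2) : drsubmx M i j = [:: y; w]`_i 0 (rshift N j).
  by rewrite [LHS]mxE [LHS]mxE rowM.
rewrite det_lblock det1 mul1r det_mx2 !drM /= !mxE.
set a : 'I_(N + 2) := rshift N 0; set b : 'I_(N + 2) := rshift N 1.
have ab : b != a by rewrite (inj_eq (@rshift_inj _ _)).
have ab0 : (U_(f a) + U_(f b) == U_(f a) + U_(o))%MM = false.
  by rewrite (inj_eq (@addmI _ _)) eq_mnm1; apply/negbTE/f_neq_o.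
have a0b : (U_(f b) + U_(o) == U_(f a) + U_(o))%MM = false.
  by rewrite (inj_eq (@addIm _ _)) eq_mnm1 (inj_eq f_inj); apply/negbTE.
apply/eqP => /(congr1 (mcoeff (U_(f a) + U_(o))%MM)).
rewrite mcoeff0 !mulrDr -!scalerAr -!mpolyXD !linearB !linearD !linearZ /=.
rewrite !mcoeffX eqxx ab0 a0b [(U_(f b) + U_(f a))%MM]addmC ab0.
rewrite !mulr0 mulr1 add0r addr0 subr0 => /eqP.
by rewrite (negPf (be_neq0 _)).
Qed.

End RationalNormalCurveCycle.

(** * Zeros of codewords and quadrics of the Orlik-Terao ideal *)

Section CodeGeometry.
Variables (K : fieldType) (k n : nat) (G : 'M[K]_(k, n)).

Lemma code_form_homog j : code_form G j \is 1.-homog.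
Proof. by apply: rpred_sum => i _; rewrite rpredZ // dhomogX /= mdeg1. Qed.

Lemma code_form_lin p o j al be :
  col p G = al *: col o G + be *: col j G ->
  code_form G p = al *: code_form G o + be *: code_form G j.
Proof.
move=> /colP eG; rewrite /code_form !scaler_sumr -big_split.
apply: eq_bigr => i _; have := eG i; rewrite !mxE => ->.
by rewrite !scalerA scalerDl.
Qed.

(** A form of degree 1 is not a unit, so it cannot divide another form of the
    family. *)
Lemma col_not_prop o j c : pairwise_nonproportional G ->
  o != j -> col j G != c *: col o G.
Proof.
move=> [form0 form_gcd] /eqP neq_oj; apply/eqP => colE.
have eform : code_form G j = c *: code_form G o.
  by rewrite -[RHS]addr0 -(scale0r (code_form G o)); apply: code_form_lin;
     rewrite scale0r addr0.
have : code_form G o \is a GRing.unit.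
  apply: (form_gcd o j neq_oj _ 1 (c%:MP)); first by rewrite mulr1.
  by rewrite eform -mul_mpolyC mulrC.
rewrite /(_ \is _) /= => /andP[/eqP eC _]; apply: (form0 o).
rewrite eC (dhomog_nemf_coeff (code_form_homog o)) ?mpolyC0 //.
by rewrite /= mdeg0.
Qed.

End CodeGeometry.

(** The orthogonal of a nonzero vector is a plane, spanned by any two
    nonproportional vectors in it. *)
Lemma plane_span (K : fieldType) (x : 'rV[K]_3) (u v t : 'cV[K]_3) :
  x != 0 -> x *m u = 0 -> x *m v = 0 -> x *m t = 0 ->
  u != 0 -> (forall c, v != c *: u) ->
  exists a b, t = a *: u + b *: v.
Proof.
move=> x0 xu xv xt u0 uv; set H := kermx x^T.
have inH (w : 'cV[K]_3) : x *m w = 0 -> (w^T <= H)%MS.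
  by move=> xw; rewrite sub_kermx -trmx_mul xw trmx0.
have sH : (u^T + v^T <= H)%MS by rewrite addsmx_sub !inH.
have rkH : (\rank H = 2)%N by rewrite /H mxrank_ker mxrank_tr rank_rV x0.
have rk2 : (\rank (u^T + v^T)%MS = 2)%N.
  apply/eqP; rewrite eqn_leq -[X in (_ <= X)%N]rkH mxrankS //=.
  have [le1 eq1] := mxrank_leqif_sup (addsmxSl u^T v^T).
  move: le1 eq1; rewrite rank_rV trmx_eq0 u0 leq_eqVlt => /orP[->|//].
  rewrite addsmx_sub => /esym/andP[_ /sub_rVP[c /(congr1 trmx)]].
  by rewrite linearZ /= !trmxK => /eqP; rewrite (negPf (uv c)).
have : (t^T <= u^T + v^T)%MS.
  apply: submx_trans (inH _ xt) _.
  by have [_ <-] := mxrank_leqif_sup sH; rewrite rkH rk2.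
case/sub_addsmxP => -[a b] /= /(congr1 trmx); rewrite trmxK => ->.
exists (a 0 0), (b 0 0); rewrite [a]mx11_scalar [b]mx11_scalar !mul_scalar_mx.
by rewrite linearD !linearZ /= !trmxK !mxE !mulr1n.
Qed.

Section QuadricsFromZeros.
Variables (K : fieldType) (n : nat) (G : 'M[K]_(3, n)).
Hypothesis G_nonprop : pairwise_nonproportional G.

(** The forms at the zeros of the codeword [x *m G] lie in the plane
    orthogonal to [x]. Removing one zero [o], each other form l_(f a) spans
    that plane together with l_o, so a further form l_p of the family is a
    combination of the two; the coefficient of l_(f a) is nonzero because l_p
    is not a multiple of l_o. *)
Lemma exists_quadric_koszul_cycle N (x : 'rV[K]_3) : x != 0 ->
  #|[set j | (x *m G) 0 j == 0]| = (N + 3)%N ->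
  exists (f : 'I_(N + 2) -> 'I_n) (z : seq 'I_(N + 2) -> {mpoly K[n]}),
  injective f /\
  [/\ alternating z, forall s, IOT G (z s), forall s, z s \is 2.-homog,
      forall s, size s != N -> z s = 0
    & (forall s, \sum_a 'X_(f a) * z (a :: s) = 0) /\
      (exists s, z s != 0)].
Proof.
move=> x0; set Z := [set j | _] => cardZ.
have [o oZ] : exists o, o \in Z.
  by apply/card_gt0P; rewrite cardZ addn3.
have cardA : (N + 2)%N = #|Z :\ o|.
  by apply: succn_inj; rewrite -addnS -cardZ (cardsD1 o) oZ.
pose f i := enum_val (cast_ord cardA i).
have f_inj : injective f by move=> i j /enum_val_inj/cast_ord_inj.
have fA i : (f i \in Z) && (f i != o).
  by have := enum_valP (cast_ord cardA i); rewrite !inE andbC.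
(* Any zero other than o can serve as p. *)
pose p := f (rshift N 0).
have colZ j : j \in Z -> x *m col j G = 0.
  rewrite inE => /eqP xj; apply/rowP => i; rewrite ord1 !mxE -[RHS]xj mxE.
  by apply: eq_bigr => l _; rewrite mxE.
have col0 j : col j G != 0.
  apply/eqP => /colP c0; have [h _] := G_nonprop; apply: (h j).
  by apply: big1 => i _; have := c0 i; rewrite !mxE => ->; rewrite scale0r.
have span a : exists c : K * K,
    (c.2 != 0) && (col p G == c.1 *: col o G + c.2 *: col (f a) G).
  have /andP[fZ fo] := fA a; have of' : o != f a by rewrite eq_sym.
  have /andP[pZ po] := fA (rshift N 0).
  have [c [d e]] := plane_span x0 (colZ _ oZ) (colZ _ fZ) (colZ _ pZ) (col0 o)
    (fun c => @col_not_prop _ _ _ _ o (f a) c G_nonprop of').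
  exists (c, d); rewrite -e eqxx andbT /=; apply/eqP => d0.
  have po' : o != p by rewrite eq_sym.
  by have /eqP[] := col_not_prop c G_nonprop po'; rewrite e d0 scale0r addr0.
pose c a := xchoose (span a).
have cP a := xchooseP (span a).
exists f, (curve_cycle f o (fun a => (c a).1) (fun a => (c a).2)); split=> //.
split.
- exact: alternating_curve_cycle.
- move=> s; apply: (curve_cycle_IOT (p := p)) => [j|a].
    by apply/eqP; have [] := G_nonprop.
  by have /andP[_ /eqP/code_form_lin] := cP a.
- exact: curve_cycle_homog.
- by move=> s sN; rewrite /curve_cycle (negPf sN).
- split; first exact: koszul_curve_cycle.
  apply: curve_cycle_neq0 => // a; first by have /andP[] := fA a.
  by have /andP[] := cP a.
Qed.

End QuadricsFromZeros.

Lemma weight_zeros (K : fieldType) n (c : 'rV[K]_n) :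
  (weight c + #|[set j | (c 0 j == 0)%R]| = n)%N.
Proof.
rewrite -[RHS]card_ord -(cardsC [set j | c 0 j == 0]) addnC; congr (_ + _)%N.
by apply: eq_card => j; rewrite !inE.
Qed.

(** Some nonzero message is orthogonal to any k chosen columns, because these
    have rank at most k in a space of dimension k + 1. *)
Lemma singleton_bound (K : fieldType) k n d (G : 'M[K]_(k.+1, n)) :
  is_linear_code G d -> (d + k <= n)%N.
Proof.
case=> rkG [_ d_min]; have kn : (k < n)%N by rewrite -rkG rank_leq_col.
pose f := widen_ord (ltnW kn); pose A := colsub f G.
have /rowV0Pn[x /sub_kermxP xA x0] : kermx A != 0.
  by rewrite kermx_eq0 -row_leq_rank -ltnNge ltnS rank_leq_col.
have xG0 : x *m G <> 0.
  have Gfree : row_free G by rewrite /row_free rkG.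
  by move=> xG; move: x0; rewrite -(mulmx_free_eq0 x Gfree) xG eqxx.
have := d_min _ (ex_intro _ x erefl) xG0.
rewrite -(leq_add2r #|[set j | (x *m G) 0 j == 0]|) weight_zeros.
apply: leq_trans; rewrite leq_add2l.
have card_f : #|f @: setT| = k.
  have f_inj : injective f by move=> i j /(congr1 val) /= ij; apply: val_inj.
  by rewrite (card_imset _ f_inj) cardsT card_ord.
apply: leq_trans (eq_leq (esym card_f)) _.
apply/subset_leq_card/subsetP => _ /imsetP[i _ ->]; rewrite inE; apply/eqP.
move/rowP/(_ i): xA; rewrite !mxE => xAi; rewrite -[RHS]xAi.
by apply: eq_bigr => l _; rewrite !mxE.
Qed.

(** * The minimum distance of a code of dimension 3 *)

Theorem proposition3p8 (K : fieldType) (n d : nat) (G : 'M[K]_(3, n))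
  (hC : is_linear_code G d)
  (hG : pairwise_nonproportional G)
  (hI : exists f, IOT G f /\ f <> 0) :
  (is_alpha (IOT G) 3 -> is_MDS G) /\
  (is_alpha (IOT G) 2 ->
     forall delta, is_linear_strand_length (IOT G) delta ->
     (n - delta - 3 <= d)%N).
Proof.
have [rkG [[c [[x ->] xG0 wd]] d_min]] := hC.
have x0 : x != 0 by apply/eqP => x0; apply: xG0; rewrite x0 mul0mx.
have := weight_zeros (x *m G); rewrite wd; set m := #|_| => dm.
have d2n := singleton_bound hC.
split=> [[_ low3]|[[f0 [If0 /eqP f0n0 f02]] low2] delta].
  have m2 : (m <= 2)%N.
    rewrite leqNgt; apply/negP => m3.
    have em : m = (m - 3 + 3)%N by rewrite subnK.
    have [f [z [_ [_ zI zh _ [_ [s /eqP zs]]]]]] := exists_quadric_koszul_cycle hG x0 em.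
    by have := low3 _ _ (zI s) zs (zh s).
  have dE : d = (n - 3 + 1)%N.
    have n3 : (2 < n)%N by rewrite -rkG rank_leq_col.
    have em : m = 2%N by apply/eqP; rewrite eqn_leq m2 -(leq_add2l d) dm d2n.
    by rewrite addn1 (subnSK n3) -[X in (X - 2)%N]dm em addnK.
  by rewrite /is_MDS -dE.
case=> s0 [F [[[f1 [If1 f1n0 f1h]] low] _ strand]].
have s02 : s0 = 2%N.
  apply/eqP; rewrite eqn_leq (low _ _ If0 _ f02) ?(low2 _ _ If1 f1n0 f1h) //.
  exact/eqP.
rewrite -subnDA leq_subLR -dm addnC leq_add2r.
have [m3|] := ltnP 2 m; last by move/leq_trans; apply; rewrite addn3.
have em : m = (m - 3 + 3)%N by rewrite subnK.
have [f [z [f_inj [z_alt zI zh z_supp [dz z_n0]]]]] := exists_quadric_koszul_cycle hG x0 em.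
rewrite addnC -leq_subLR.
have [j ej] := linear_strand_koszul F low2 f_inj z_alt zI zh z_supp dz z_n0.
by apply: (strand _ j); rewrite ej s02.
Qed.
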